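(* Let $U_1$ and $U_2$ be two timed automaton templates with conjunctive guards, let $Q\in\{E,E_{\mathit{inf}},E_{\mathit{fin}}\}$, and let $\Phi(1_l)$, $l\in\{1,2\}$, be an IMTL path formula whose atomic propositions refer only to instance $1$ of template $U_l$. Define $c_1=1,c_2=2$ if $Q=E_{\mathit{inf}}$; $c_1=c_2=1$ if $Q=E_{\mathit{fin}}$; $c_1=2|U_2|$, $c_2=2|U_2|+1$ if $Q=E$. Then: (i) for all $n\ge c_2$, $(U_1,U_2)^{(1,n)}\models Q\Phi(1_2)\Rightarrow(U_1,U_2)^{(1,c_2)}\models Q\Phi(1_2)$; (ii) for all $n\ge c_1$, $(U_1,U_2)^{(1,n)}\models Q\Phi(1_1)\Rightarrow(U_1,U_2)^{(1,c_1)}\models Q\Phi(1_1)$.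
   Context: Temporal constraints: for a finite set $C$ of clocks, $TC(C)$ is generated by $\top$, $\neg$, $\vee$, $x\sim y$ and $x\sim q$ with $x,y\in C$, $q\in\mathbb{Q}^{\geq0}$, $\sim\in\{<,\le,>,\ge,=\}$. A timed automaton (TA) template is $U_l=\langle S_l,\hat s_l,C_l,\Gamma_l,\tau_l,I_l\rangle$ with finite state set $S_l$, initial state $\hat s_l$, finite clock set $C_l$, finite set $\Gamma_l$ of Boolean guards over states, transitions $\tau_l\subseteq S_l\times TC(C_l)\times 2^{C_l}\times\Gamma_l\times S_l$, and invariants $I_l:S_l\to TC(C_l)$ with $I_l(\hat s_l)=\top$; $|U_l|:=|S_l|$. For natural numbers $n_1,n_2$, the network $(U_1,U_2)^{(n_1,n_2)}$ is the asynchronous parallel composition of instances $U_l^i$ ($i\in[1,n_l]$), each a disjoint copy of $U_l$. Conjunctive guards: every guard of a transition of instance $U_l^i$ is a conjunction, over every other instance $U_h^j$, of a disjunction $\hat s_h(j)\vee s^1(j)\vee\dots\vee s^q(j)$ of propositions ''instance $U_h^j$ is in state $s$'', where the initial state $\hat s_h(j)$ always appears. A configuration gives each instance a state and a clock valuation into $\mathbb{R}^{\ge0}$ satisfying the state's invariant; the initial configuration has all instances in initial states with clocks $0$. Transitions: a delay by $d\in\mathbb{R}^{\ge0}$ keeps states, increases all clocks by $d$, invariants holding throughout; a discrete step lets a single instance in state $s$ take $(s,g,r,\gamma,t)$ if its clocks satisfy $g$ and the global state vector satisfies $\gamma$, moving to $t$ and resetting clocks in $r$, provided the new invariant holds; other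 instances unchanged. A timed computation is a finite or infinite sequence $(\mathfrak c_0,t_0)(\mathfrak c_1,t_1)\dots$ from the initial configuration with $t_0=0$, each step a delay $d>0$ ($t_{v+1}=t_v+d$) or a discrete step ($t_{v+1}=t_v$); it is infinite, deadlocked (maximal finite, ending where all discrete transitions are disabled), or finite. It induces an s-path $\rho(t)=(\text{states of }\mathfrak c_v,\text{clocks of }\mathfrak c_v+(t-t_v))$ on $[t_v,t_{v+1})$. Atomic propositions $p(l,i)$, $p\in S_l$, hold iff $U_l^i$ is in state $p$. An IMTL path formula is built from atomic propositions with $\wedge$, $\neg$ and $\Phi_1\mathcal{U}_{\sim q}\Phi_2$ ($q\in\mathbb{Q}^{\ge0}$), where $\rho\models\Phi_1\mathcal{U}_{\sim q}\Phi_2$ iff for some $t'\sim q$ the suffix from $t'$ satisfies $\Phi_2$ and the suffix from every $t\in[0,t')$ satisfies $\Phi_1$; an atomic proposition holds on a path iff it holds at time $0$. $E\Phi$ (resp. $E_{\mathit{inf}}\Phi$, $E_{\mathit{fin}}\Phi$) holds iff some s-path from the initial configuration that is infinite or deadlocked (resp. infinite, resp. finite) satisfies $\Phi$. *)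

(* Defs.v *)
From mathcomp Require Import all_boot all_order all_algebra.
From mathcomp Require Import interval_inference reals.

Set Implicit Arguments.
Unset Strict Implicit.
Unset Printing Implicit Defensive.

Import Order.TTheory GRing.Theory Num.Theory.
Local Open Scope ring_scope.

Inductive cmp := CLt | CLe | CGt | CGe | CEq.

Definition cmp_sat (R : realType) (o : cmp) (a b : R) : bool :=
  match o with
  | CLt => a < b
  | CLe => a <= b
  | CGt => a > b
  | CGe => a >= b
  | CEq => a == b
  end.

Inductive tc (C : Type) :=
  | TCtop
  | TCnot of tc C
  | TCor of tc C & tc C
  | TCclock of C & cmp & C
  | TCconst of C & cmp & {nonneg rat}.

Arguments TCtop {C}.

Fixpoint tc_sat (R : realType) (C : Type) (v : C -> R) (g : tc C) : bool :=
  match g with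
  | TCtop => true
  | TCnot g1 => ~~ tc_sat v g1
  | TCor g1 g2 => tc_sat v g1 || tc_sat v g2
  | TCclock x o y => cmp_sat o (v x) (v y)
  | TCconst x o q => cmp_sat o (v x) (ratr q%:num)
  end.

Inductive tidx := T1 | T2.

(* The guards of either template mention the states of both, so the state sets
   (with their initial states) are fixed before the templates themselves. *)
Record state_space := StateSpace { state :> finType; init_state : state }.

(* A conjunctive guard gamma is given by the disjuncts it allows: guard_states
   gamma h is the set of states s such that the proposition "U_h^j is in state
   s" occurs in the conjunct for another instance U_h^j. The transition relation
   is not required to be finite. *)
Record template (S : tidx -> state_space) (l : tidx) := Template {
  clock : finType;
  guard : finType;
  guard_states : guard -> forall h : tidx, {set S h};
  guard_init : forall (gamma : guard) (h : tidx),
    init_state (S h) \in guard_states gamma h;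
  trans : S l -> tc clock -> {set clock} -> guard -> S l -> Prop;
  inv : S l -> tc clock;
  inv_init : inv (init_state (S l)) = TCtop
}.

Definition sizes (n1 n2 : nat) (l : tidx) : nat :=
  match l with T1 => n1 | T2 => n2 end.

(* The pair (l, j) is the instance U_l^(j+1). *)
Definition inst (n : tidx -> nat) : Type := {l : tidx & 'I_(n l)}.

Record gstate (R : realType) (S : tidx -> state_space)
    (U : forall l, template S l) (n : tidx -> nat) := GState {
  loc : forall u : inst n, S (tag u);
  clk : forall u : inst n, clock (U (tag u)) -> R
}.

Arguments clk {R S U n} g u _.

Definition is_config (R : realType) (S : tidx -> state_space)
    (U : forall l, template S l) (n : tidx -> nat) (c : gstate R U n) : Prop :=
  forall u : inst n,
    (forall x, 0 <= clk c u x) /\ tc_sat (clk c u) (inv (U (tag u)) (loc c u)).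

Definition init_config (R : realType) (S : tidx -> state_space)
    (U : forall l, template S l) (n : tidx -> nat) : gstate R U n :=
  @GState R S U n (fun u => init_state (S (tag u))) (fun u x => 0).

Definition shift (R : realType) (S : tidx -> state_space)
    (U : forall l, template S l) (n : tidx -> nat)
    (c : gstate R U n) (d : R) : gstate R U n :=
  @GState R S U n (loc c) (fun u x => clk c u x + d).

Definition delay_step (R : realType) (S : tidx -> state_space)
    (U : forall l, template S l) (n : tidx -> nat)
    (c : gstate R U n) (d : R) (c' : gstate R U n) : Prop :=
  [/\ 0 <= d, c' = shift c d
    & forall e : R, 0 <= e <= d -> is_config (shift c e)].

Definition guard_sat (R : realType) (S : tidx -> state_space)
    (U : forall l, template S l) (n : tidx -> nat)
    (c : gstate R U n) (u : inst n) (gamma : guard (U (tag u))) : Prop :=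
  forall w : inst n, w <> u -> loc c w \in guard_states gamma (tag w).

Definition discrete_step (R : realType) (S : tidx -> state_space)
    (U : forall l, template S l) (n : tidx -> nat)
    (c c' : gstate R U n) : Prop :=
  exists (u : inst n) (g : tc (clock (U (tag u)))) (r : {set clock (U (tag u))})
         (gamma : guard (U (tag u))),
    [/\ trans (loc c u) g r gamma (loc c' u),
        tc_sat (clk c u) g /\ guard_sat c gamma,
        forall x, clk c' u x = if x \in r then 0 else clk c u x,
        forall w : inst n, w <> u ->
          loc c' w = loc c w /\ forall x, clk c' w x = clk c w x
      & is_config c'].

(* tlast = Some k: the finite sequence of indices 0, ..., k (later values of cfg
   and time are irrelevant); tlast = None: an infinite sequence. *)
Record timed_seq (R : realType) (S : tidx -> state_space)
    (U : forall l, template S l) (n : tidx -> nat) := TimedSeq {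
  tlast : option nat;
  cfg : nat -> gstate R U n;
  time : nat -> R
}.

Definition has_index (R : realType) (S : tidx -> state_space)
    (U : forall l, template S l) (n : tidx -> nat)
    (x : timed_seq R U n) (v : nat) : bool :=
  if tlast x is Some k then (v <= k)%N else true.

Definition timed_computation (R : realType) (S : tidx -> state_space)
    (U : forall l, template S l) (n : tidx -> nat)
    (x : timed_seq R U n) : Prop :=
  [/\ cfg x 0%N = init_config R U n, time x 0%N = 0
    & forall v : nat, has_index x v.+1 ->
        (exists d : R, [/\ 0 < d, delay_step (cfg x v) d (cfg x v.+1)
                         & time x v.+1 = time x v + d]) \/
        (discrete_step (cfg x v) (cfg x v.+1) /\ time x v.+1 = time x v)].

Definition infinite (R : realType) (S : tidx -> state_space)
    (U : forall l, template S l) (n : tidx -> nat)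
    (x : timed_seq R U n) : Prop :=
  tlast x = None.

Definition finite (R : realType) (S : tidx -> state_space)
    (U : forall l, template S l) (n : tidx -> nat)
    (x : timed_seq R U n) : Prop :=
  exists k : nat, tlast x = Some k.

(* Maximality is with respect to discrete steps: a deadlocked computation may
   still be able to let time elapse. *)
Definition deadlocked (R : realType) (S : tidx -> state_space)
    (U : forall l, template S l) (n : tidx -> nat)
    (x : timed_seq R U n) : Prop :=
  exists2 k : nat, tlast x = Some k &
    forall c' : gstate R U n, ~ discrete_step (cfg x k) c'.

(* A partial function from times to global states, as its graph: a finite or
   Zeno computation only defines a bounded path. *)
Definition spath_graph (R : realType) (S : tidx -> state_space)
    (U : forall l, template S l) (n : tidx -> nat) : Type :=
  R -> gstate R U n -> Prop.

(* The v-th piece lives on [t_v, t_(v+1)); the last piece of a finite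
   computation, for which there is no t_(v+1), is the single time t_v. *)
Definition spath (R : realType) (S : tidx -> state_space)
    (U : forall l, template S l) (n : tidx -> nat)
    (x : timed_seq R U n) : spath_graph R U n :=
  fun t c => exists v : nat,
    [/\ has_index x v, time x v <= t,
        if has_index x v.+1 then t < time x v.+1 else t == time x v
      & c = shift (cfg x v) (t - time x v)].

Definition suffix_from (R : realType) (S : tidx -> state_space)
    (U : forall l, template S l) (n : tidx -> nat)
    (rho : spath_graph R U n) (t0 : R) : spath_graph R U n :=
  fun t c => 0 <= t /\ rho (t0 + t) c.

Definition defined_at (R : realType) (S : tidx -> state_space)
    (U : forall l, template S l) (n : tidx -> nat)
    (rho : spath_graph R U n) (t : R) : Prop :=
  exists c, rho t c.

(* Instance numbers start at 1 and are plain naturals, so that one formula is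
   meaningful for networks of different sizes. *)
Inductive imtl (S : tidx -> state_space) :=
  | Atom (l : tidx) (i : nat) (p : S l)
  | And of imtl S & imtl S
  | Not of imtl S
  | Until of imtl S & cmp & {nonneg rat} & imtl S.

Definition atom_holds (R : realType) (S : tidx -> state_space)
    (U : forall l, template S l) (n : tidx -> nat)
    (c : gstate R U n) (l : tidx) (i : nat) (p : S l) : Prop :=
  exists2 j : 'I_(n l), j.+1 = i & loc c (Tagged (fun h => 'I_(n h)) j) = p.

Fixpoint imtl_sat (R : realType) (S : tidx -> state_space)
    (U : forall l, template S l) (n : tidx -> nat)
    (rho : spath_graph R U n) (Phi : imtl S) : Prop :=
  match Phi with
  | Atom l i p => exists2 c, rho 0 c & atom_holds c i p
  | And Phi1 Phi2 => imtl_sat rho Phi1 /\ imtl_sat rho Phi2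
  | Not Phi1 => ~ imtl_sat rho Phi1
  | Until Phi1 o q Phi2 =>
      exists t' : R,
        [/\ 0 <= t', cmp_sat o t' (ratr q%:num), defined_at rho t',
            imtl_sat (suffix_from rho t') Phi2
          & forall t : R, 0 <= t < t' -> imtl_sat (suffix_from rho t) Phi1]
  end.

Fixpoint only_about (S : tidx -> state_space) (l : tidx) (i : nat)
    (Phi : imtl S) : Prop :=
  match Phi with
  | Atom h j _ => h = l /\ j = i
  | And Phi1 Phi2 => only_about l i Phi1 /\ only_about l i Phi2
  | Not Phi1 => only_about l i Phi1
  | Until Phi1 _ _ Phi2 => only_about l i Phi1 /\ only_about l i Phi2
  end.

Inductive quantifier := QE | QEinf | QEfin.

Definition admissible (R : realType) (S : tidx -> state_space)
    (U : forall l, template S l) (n : tidx -> nat)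
    (Q : quantifier) (x : timed_seq R U n) : Prop :=
  match Q with
  | QE => infinite x \/ deadlocked x
  | QEinf => infinite x
  | QEfin => finite x
  end.

Definition models (R : realType) (S : tidx -> state_space)
    (U : forall l, template S l) (n : tidx -> nat)
    (Q : quantifier) (Phi : imtl S) : Prop :=
  exists x : timed_seq R U n,
    [/\ timed_computation x, admissible Q x & imtl_sat (spath x) Phi].

Definition template_size (S : tidx -> state_space) (l : tidx)
    (U : template S l) : nat := #|S l|.

Definition cutoff1 (S : tidx -> state_space) (U : forall l, template S l)
    (Q : quantifier) : nat :=
  match Q with
  | QE => 2 * template_size (U T2)
  | QEinf => 1
  | QEfin => 1
  end%N.

Definition cutoff2 (S : tidx -> state_space) (U : forall l, template S l)
    (Q : quantifier) : nat :=
  match Q with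
  | QE => 2 * template_size (U T2) + 1
  | QEinf => 2
  | QEfin => 1
  end%N.

(* Main.v *)
(** A conjunctive guard that holds keeps holding when instances are removed, so
    a computation of a large network projects to the instances one keeps, the
    steps of the removed ones becoming stuttering, which can be deleted without
    changing the s-path. Two things may break. An infinite computation may become
    finite, unless one also keeps an instance that moves infinitely often (if
    time elapses only finitely often). A deadlocked computation may end in a
    configuration where a step becomes enabled; this is prevented by keeping, for
    every state of [U T2] occupied at the end, two instances in that state: a
    guard speaks about the *other* instances, and one of the two is always
    another one. *)

Require Import Defs.
From mathcomp Require Import all_boot all_order all_algebra.
From mathcomp Require Import boolp reals.
From mathcomp Require Import fingroup.perm.

Set Implicit Arguments.
Unset Strict Implicit.
Unset Printing Implicit Defensive.

Import Order.TTheory GRing.Theory Num.Theory.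

(** * Selections and injections of finite sets *)

Lemma infinite_pigeonhole (T : finType) (e : nat -> T) :
  exists a, forall N, exists2 v, (N <= v)%N & e v = a.
Proof.
apply: contrapT => /forallNP H.
have {}H a : exists N, forall v, (N <= v)%N -> e v <> a.
  have /existsNP[N HN] := H a; exists N => v Nv ev; apply: HN; by exists v.
have [N HN] := choice H.
pose M := \max_a N a.
by have := HN (e M) M (leq_bigmax (e M)).
Qed.

(** Serves to lift the step of one instance to a whole network state. [{classic I}] supplies the
    decidable equality that [dfwith] needs. *)
Lemma exists_dep_update (I : Type) (T : I -> Type) (F : forall i, T i) (i : I)
    (a : T i) :
  exists2 G : forall j, T j, G i = a & forall j, j <> i -> G j = F j.
Proof.
pose J : eqType := {classic I}.
exists (@dfwith J T F i a); first exact: dfwith_in.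
by move=> j ji; apply: dfwith_out; apply/eqP => /esym.
Qed.

(** Take the first two elements of every fiber: a fiber with fewer than two is kept entirely, any
    other one provides [w1] and [w2]. *)
Lemma exists_two_per_fiber (T K : finType) (k : T -> K) :
  exists2 A : {set T}, (#|A| <= 2 * #|K|)%N &
    forall w, w \in A \/ exists w1 w2,
      [/\ w1 \in A, w2 \in A, w1 <> w2, k w1 = k w & k w2 = k w].
Proof.
pose X s := enum [set w | k w == s].
have XA w s : w \in take 2 (X s) -> w \in \bigcup_s [set w in take 2 (X s)].
  by move=> wX; apply/bigcupP; exists s; rewrite ?inE.
have Xk w s : w \in X s -> k w = s by rewrite mem_enum inE => /eqP.
exists (\bigcup_s [set w in take 2 (X s)]).
  apply: (@leq_trans (\sum_(s : K) 2)); last by rewrite sum_nat_const mulnC.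
  elim/big_ind2: _ => [|m A p B Am Bp|s _]; first by rewrite cards0.
    by rewrite (leq_trans (leq_card_setU A B)) // leq_add.
  rewrite cardsE (leq_trans (card_size _)) // size_take_min.
  exact: geq_minl.
move=> w; have : w \in X (k w) by rewrite mem_enum inE.
have := enum_uniq [set v | k v == k w]; rewrite -/(X (k w)).
have := XA ^~ (k w); have := Xk ^~ (k w).
case: (X (k w)) => [|a [|b s]] //= Hk HA.
  by move=> _ wa; left; apply: HA.
rewrite inE negb_or => /andP[/andP[/eqP ab _] _] _; right; exists a, b.
by split=> //; [apply: HA|apply: HA|apply: Hk|apply: Hk]; rewrite !inE eqxx ?orbT.
Qed.

(** List [A] before its complement and cut after [c] entries: as [#|A| <= c], nothing of [A] is
    lost. *)
Lemma exists_injection_covering (c : nat) (T : finType) (A : {set T}) :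
  (#|A| <= c <= #|T|)%N ->
  exists2 h : 'I_c -> T, injective h & forall j, j \in A -> exists i, h i = j.
Proof.
move=> /andP[Ac cT]; pose s := enum A ++ enum (~: A).
have ss : size s = #|T| by rewrite size_cat -!cardE cardsC.
have us : uniq s.
  rewrite cat_uniq !enum_uniq /= andbT; apply/hasPn => w.
  by rewrite !mem_enum inE.
(* [nth] needs a default element, and [T] may be empty when [c = 0]. *)
have [c0|c0] := posnP c.
  have A0 : A = set0 by apply/eqP; rewrite -cards_eq0 -leqn0 -c0.
  subst c; have F (i : 'I_0) : T by case: i.
  by exists F => [[]//|j]; rewrite A0 inE.
have /card_gt0P[x0 _] : (0 < #|T|)%N by exact: leq_trans cT.
exists (fun i : 'I_c => nth x0 s i) => [i j /eqP|j jA].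
  by rewrite nth_uniq ?ss ?(leq_trans (ltn_ord _)) // => /eqP /val_inj.
have jl : (index j (enum A) < #|A|)%N by rewrite cardE index_mem mem_enum.
exists (Ordinal (leq_trans jl Ac)) => /=.
by rewrite nth_cat -cardE jl nth_index ?mem_enum.
Qed.

Local Open Scope ring_scope.

(** * Steps and stutters of a network *)

Section Network.
Variables (R : realType) (S : tidx -> state_space).
Variable U : forall l, template S l.

(** [discrete_step] with its mover exposed, so that one can ask whether the mover is kept. *)
Definition step_of (n : tidx -> nat) (u : inst n) (c c' : gstate R U n) : Prop :=
  exists (g : tc (clock (U (tag u)))) (r : {set clock (U (tag u))})
         (gamma : guard (U (tag u))),
    [/\ trans (loc c u) g r gamma (loc c' u),
        tc_sat (clk c u) g /\ guard_sat c gamma,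
        forall x, clk c' u x = if x \in r then 0 else clk c u x,
        forall w : inst n, w <> u ->
          loc c' w = loc c w /\ forall x, clk c' w x = clk c w x
      & is_config c'].

Definition moves (n : tidx -> nat) (x : timed_seq R U n) (v : nat) : Prop :=
  (exists d : R, [/\ 0 < d, delay_step (cfg x v) d (cfg x v.+1)
                   & time x v.+1 = time x v + d]) \/
  (discrete_step (cfg x v) (cfg x v.+1) /\ time x v.+1 = time x v).

Definition stutters (n : tidx -> nat) (x : timed_seq R U n) (v : nat) : Prop :=
  cfg x v.+1 = cfg x v /\ time x v.+1 = time x v.

Lemma has_indexW (n : tidx -> nat) (x : timed_seq R U n) (v w : nat) :
  (v <= w)%N -> has_index x w -> has_index x v.
Proof. by rewrite /has_index; case: (tlast x) => // k; apply: leq_trans. Qed.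

Lemma is_config_cfg (n : tidx -> nat) (x : timed_seq R U n) (v : nat) :
  timed_computation x -> has_index x v -> is_config (cfg x v).
Proof.
case=> x0 _ xS; case: v => [_|v /xS[[d [_ [d0 -> +] _]]|[[u [g [r [gamma []]]]] //]]].
  by rewrite x0 => u; split=> //=; rewrite inv_init.
by apply; rewrite d0 lexx.
Qed.

(** * Deleting stutters *)

Section Destutter.
Variables (n : tidx -> nat) (x : timed_seq R U n).
Hypothesis weak_step : forall v, has_index x v.+1 -> moves x v \/ stutters x v.
Hypothesis moves_io :
  tlast x = None -> forall N, exists2 v, (N <= v)%N & moves x v.

(* The [w]-th index of the stutter-free sequence stands for all the [v] with
   [count v = w]. Comparing successive configurations instead would also delete
   genuine self-loops. *)
Let count v := (\sum_(i < v) `[< moves x i >])%N.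

Let countS v : count v.+1 = (count v + `[< moves x v >])%N.
Proof. by rewrite /count big_ord_recr. Qed.

Let count_move v : moves x v -> count v.+1 = (count v).+1.
Proof. by move=> mv; rewrite countS; move/asboolP: mv => ->; rewrite addn1. Qed.

Let leq_count v w : (v <= w)%N -> (count v <= count w)%N.
Proof.
move=> /subnKC <-; elim: (w - v)%N => [|k IH]; first by rewrite addn0.
by rewrite addnS countS (leq_trans IH) ?leq_addr.
Qed.

(** A move in between would raise [count], so only stutters separate two indices of equal count. *)
Let count_inj v w : has_index x v -> has_index x w -> count v = count w ->
  (cfg x v, time x v) = (cfg x w, time x w).
Proof.
wlog vw : v w / (v <= w)%N => [H hv hw E|hv].
  by case/orP: (leq_total v w) => ?; [apply: H|symmetry; apply: H].
rewrite -(subnKC vw); elim: (w - v)%N => [|k IH]; first by rewrite addn0.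
rewrite addnS => hk E.
have hk' := has_indexW (leqnSn _) hk.
have [mk|[-> ->]] := weak_step hk.
  by have := leq_count (leq_addr k v); rewrite E count_move // ltnn.
apply: IH => //; apply/eqP; rewrite eqn_leq leq_count ?leq_addr //= E leq_count //.
Qed.

Let count_hit w K : (w < count K)%N ->
  exists v, [/\ (v < K)%N, count v = w & moves x v].
Proof.
elim: K => [|K IH]; first by rewrite /count big_ord0.
rewrite countS; have [/IH[v [vK cv mv]] _|Kw] := ltnP w (count K).
  by exists v; rewrite ltnS ltnW.
case: asboolP => [mK|_]; last by rewrite addn0 ltnNge Kw.
by rewrite addn1 ltnS => wK; exists K; split=> //; apply/eqP; rewrite eqn_leq Kw.
Qed.

Let count_unbounded : tlast x = None -> forall w, exists K, (w < count K)%N.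
Proof.
move=> xN; elim=> [|w [K wK]].
  by have [v _ mv] := moves_io xN 0; exists v.+1; rewrite count_move.
have [v Kv mv] := moves_io xN K; exists v.+1; rewrite count_move // ltnS.
exact: leq_trans wK (leq_count Kv).
Qed.

Lemma destutter :
  cfg x 0 = init_config R U n -> time x 0 = 0 ->
  exists y : timed_seq R U n,
    [/\ timed_computation y, forall t c, spath y t c <-> spath x t c,
        infinite x -> infinite y
      & forall k, tlast x = Some k ->
          exists2 K, tlast y = Some K & cfg y K = cfg x k].
Proof.
move=> x0 t0.
(* By [count_inj] the choice of [v] does not matter; the default value is taken only if no index has
   count [w]. *)
have H w : exists z, forall v, has_index x v -> count v = w ->
    z = (cfg x v, time x v).
  have [[v [hv cv]]|nv] := pselect (exists v, has_index x v /\ count v = w).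
    by exists (cfg x v, time x v) => v' hv' cv'; apply: count_inj => //; rewrite cv.
  by exists (cfg x 0, time x 0) => v hv cv; case: nv; exists v.
have {H}[z zE] := choice H.
pose y := @TimedSeq R S U n (omap count (tlast x)) (fst \o z) (snd \o z).
have cfgE v : has_index x v -> cfg y (count v) = cfg x v.
  by move=> hv; rewrite /y /= (zE _ v hv erefl).
have timeE v : has_index x v -> time y (count v) = time x v.
  by move=> hv; rewrite /y /= (zE _ v hv erefl).
have hit w : has_index y w.+1 ->
    exists v, [/\ has_index x v.+1, count v = w & moves x v].
  rewrite /has_index /y /=; case xE: (tlast x) => [k|] /=.
    by move=> /count_hit[v [vk cv mv]]; exists v.
  move=> _; have [K wK] := count_unbounded xE w.
  by have [v [_ cv mv]] := count_hit wK; exists v.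
have hasy v : has_index x v -> has_index y (count v).
  by rewrite /has_index /y /=; case: (tlast x) => //= k; apply: leq_count.
have c0 : count 0 = 0%N by rewrite /count big_ord0.
have h0 : has_index x 0 by rewrite /has_index; case: (tlast x).
exists y; split.
- split; [by rewrite -c0 cfgE|by rewrite -c0 timeE|].
  move=> w /hit[v [hv <- mv]]; have hv' := has_indexW (leqnSn v) hv.
  rewrite -count_move // !cfgE // !timeE //.
- move=> t c; split=> [[w [hw wt]]|[v [hv vt]]].
    case: ifP => [hw1|hw1].
      have [v [hv cv mv]] := hit _ hw1; have hv' := has_indexW (leqnSn v) hv.
      move: wt; rewrite -cv -count_move // !cfgE // !timeE // => wt tw cE.
      by exists v; split=> //; rewrite hv.
    have [k xk wk] : exists2 k, tlast x = Some k & w = count k.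
      move: hw hw1; rewrite /has_index /y /=.
      case: (tlast x) => //= k wk kw; exists k => //.
      by apply/eqP; rewrite eqn_leq wk leqNgt kw.
    have hk : has_index x k by rewrite /has_index xk.
    move: wt; rewrite wk cfgE // timeE // => kt tk cE; exists k; split=> //.
    by rewrite {1}/has_index xk ltnn.
  have hcv := hasy v hv.
  case: ifP => [hv1 tv cE|hv1 tv cE].
    (* A stutter has an empty interval [[t_v, t_(v+1))], so the piece containing [t] comes from a
       move. *)
    have [mv|[_ E]] := weak_step hv1; last by move: tv; rewrite E ltNge vt.
    exists (count v); split=> //; rewrite ?cfgE ?timeE //.
    by rewrite -count_move // hasy // timeE.
  exists (count v); split=> //; rewrite ?cfgE ?timeE //.
  suff -> : has_index y (count v).+1 = false by [].
  move: hv hv1; rewrite /has_index /y /=; case: (tlast x) => //= k vk vk1.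
  have -> : v = k by apply/eqP; rewrite eqn_leq vk leqNgt vk1.
  exact: ltnn.
- by rewrite /infinite /y /= => ->.
- move=> k xk; exists (count k); first by rewrite /y /= xk.
  by rewrite cfgE // /has_index xk.
Qed.

End Destutter.

(** * Projection to the kept instances *)

Section Projection.
Variables (m n : tidx -> nat) (f : forall l, 'I_(m l) -> 'I_(n l)).
Hypothesis f_inj : forall l, injective (@f l).

Definition embed (u : inst m) : inst n :=
  Tagged (fun h => 'I_(n h)) (f (tagged u)).

Definition proj (c : gstate R U n) : gstate R U m :=
  @GState R S U m (fun u => loc c (embed u)) (fun u => clk c (embed u)).

(** Indices and times are kept, so steps of discarded instances become stutters; the result need not
    be a timed computation. *)
Definition proj_seq (x : timed_seq R U n) : timed_seq R U m :=
  TimedSeq (tlast x) (proj \o cfg x) (time x).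

Lemma embed_inj : injective embed.
Proof.
move=> [l j] [l' j'] E; have El : l = l' := congr1 tag E; subst l'.
(* Comparing values in [nat] avoids a dependent equality. *)
have /val_inj/f_inj -> // : f j = f j' :> nat.
exact: (congr1 (fun w : inst n => nat_of_ord (tagged w)) E).
Qed.

Lemma proj_config c : is_config c -> is_config (proj c).
Proof. by move=> cc u; apply: cc (embed u). Qed.

Lemma proj_delay_step c d c' :
  delay_step c d c' -> delay_step (proj c) d (proj c').
Proof. by case=> d0 -> H; split=> // e /H/proj_config. Qed.

(** The guard has fewer instances to check, and injectivity sends those other than [u] to instances
    other than [embed u]. *)
Lemma proj_step_of c c' u :
  step_of (embed u) c c' -> step_of u (proj c) (proj c').
Proof.
case=> g [r [gamma [tr [cg gg] rs fr cf]]]; exists g, r, gamma; split=> //.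
- split=> // w wu; apply: (gg (embed w)); by move=> /embed_inj.
- by move=> w wu; apply: (fr (embed w)); move=> /embed_inj.
- exact: proj_config.
Qed.

Lemma proj_stutter c c' w :
  (forall u, embed u <> w) -> step_of w c c' -> proj c' = proj c.
Proof.
move=> wN [g [r [gamma [_ _ _ fr _]]]]; rewrite /proj; congr GState.
  by apply: functional_extensionality_dep => u; have [] := fr _ (wN u).
apply: functional_extensionality_dep => u; apply/funext => z.
by have [_] := fr _ (wN u); apply.
Qed.

(* [ecast] is there because [loc] is dependent; the hypothesis says that some
   kept instance other than [u] is in the same state as [w]. *)
Lemma proj_deadlock c :
  is_config c ->
  (forall u w, w <> embed u -> exists u' : inst m, exists E : tag (embed u') = tag w,
     u' <> u /\ ecast l (S l) E (loc c (embed u')) = loc c w) ->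
  (forall c', ~ discrete_step c c') -> forall c', ~ discrete_step (proj c) c'.
Proof.
move=> cc cov dead c' [u [g [r [gamma [tr [cg gg] rs fr cf]]]]].
(* Lift the enabled step to the large network by changing only [embed u]; this contradicts
   [dead]. *)
have [L Lu LN] := exists_dep_update (loc c) (i := embed u) (loc c' u).
have [K Ku KN] := exists_dep_update (clk c) (i := embed u) (clk c' u).
apply: (dead (GState L K)); exists (embed u), g, r, gamma; split=> /=.
- by rewrite Lu.
- split=> // w wu; have [u' [E [u'u]]] := cov _ _ wu.
  have := gg u' u'u; rewrite /proj /= => h.
  by move: (loc c w); case: _ / E => s <- /=.
- by move=> z; rewrite Ku rs.
- by move=> w wu; rewrite LN // KN.
- move=> w; have [->|wu] := pselect (w = embed u); last first.
    by rewrite /= LN // KN //; apply: cc.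
  by rewrite /= Lu Ku; apply: (cf u).
Qed.

Lemma proj_moves x v w :
  time x v.+1 = time x v -> step_of (embed w) (cfg x v) (cfg x v.+1) ->
  moves (proj_seq x) v.
Proof. by move=> tE st; right; split=> //; exists w; apply: proj_step_of. Qed.

Lemma proj_weak_step x v : timed_computation x -> has_index x v.+1 ->
  moves (proj_seq x) v \/ stutters (proj_seq x) v.
Proof.
case=> _ _ xS /xS[[d [d0 dl tE]]|[[w st] tE]].
  by left; left; exists d; split=> //; apply: proj_delay_step.
have [[u uw]|wN] := pselect (exists u, embed u = w).
  by left; apply: (proj_moves (w := u)) => //; rewrite uw.
by right; split=> //; apply: (proj_stutter _ st) => u uw; apply: wN; exists u.
Qed.

Lemma spath_proj_seq x t c :
  spath (proj_seq x) t c <-> exists2 c', spath x t c' & c = proj c'.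
Proof.
split=> [[v [hv vt tv ->]]|[_ [v [hv vt tv ->]] ->]]; last by exists v.
by exists (shift (cfg x v) (t - time x v)) => //; exists v.
Qed.

(** Both paths are general because [Until] passes to suffixes, and an equivalence is needed to get
    through [Not]. Atoms agree as [j0] and [f j0] both carry number [i]. *)
Lemma imtl_sat_proj l i (j0 : 'I_(m l)) (Phi : imtl S) :
  only_about l i Phi -> j0.+1 = i -> (f j0).+1 = i ->
  forall (rho : spath_graph R U n) (rho' : spath_graph R U m),
  (forall t c, rho' t c <-> exists2 c', rho t c' & c = proj c') ->
  imtl_sat rho' Phi <-> imtl_sat rho Phi.
Proof.
move=> + j0i fj0i; elim: Phi => /= [h i' p [hl ii]|P1 I1 P2 I2 [a1 a2]|P1 I1 a1
    |P1 I1 o q P2 I2 [a1 a2]] rho rho' rr.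
- subst h i'; split=> [[_ /rr[c rc ->] [j ji jp]]|[c rc [j ji jp]]].
    exists c => //; exists (f j0) => //; rewrite -jp /=.
    by have -> : j = j0 by apply: val_inj; apply: succn_inj; rewrite ji.
  exists (proj c); first by apply/rr; exists c.
  exists j0 => //; rewrite -jp /= /embed /=.
  by have -> : j = f j0 by apply: val_inj; apply: succn_inj; rewrite ji.
- by have := I1 a1 _ _ rr; have := I2 a2 _ _ rr; tauto.
- by have := I1 a1 _ _ rr; tauto.
have rs t0 : forall t c, suffix_from rho' t0 t c <->
    exists2 c', suffix_from rho t0 t c' & c = proj c'.
  move=> t c; split=> [[tt /rr[c' ? ?]]|[c' [tt ?] ?]]; first by exists c'.
  by split=> //; apply/rr; exists c'.
split=> -[t [t0 tq td s2 s1]]; exists t; split=> //.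
- by case: td => _ /rr[c' ? _]; exists c'.
- by apply/(I2 a2 _ _ (rs t)).
- by move=> s /s1 /(I1 a1 _ _ (rs s)).
- by case: td => c' ?; exists (proj c'); apply/rr; exists c'.
- by apply/(I2 a2 _ _ (rs t)).
- by move=> s /s1 ?; apply/(I1 a1 _ _ (rs s)).
Qed.

(** The last hypothesis ensures that an infinite computation stays infinite when stutters are
    deleted. *)
Lemma project_computation x l i (j0 : 'I_(m l)) (Phi : imtl S) :
  only_about l i Phi -> j0.+1 = i -> (f j0).+1 = i ->
  timed_computation x -> imtl_sat (spath x) Phi ->
  (infinite x -> forall N, exists2 v, (N <= v)%N & moves (proj_seq x) v) ->
  exists y : timed_seq R U m,
    [/\ timed_computation y, imtl_sat (spath y) Phi, infinite x -> infinite y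
      & forall k, tlast x = Some k ->
          exists2 K, tlast y = Some K & cfg y K = proj (cfg x k)].
Proof.
move=> aPhi j0i fj0i xc xPhi io; have [x0 t0 _] := xc.
have cfg0 : cfg (proj_seq x) 0 = init_config R U m by rewrite /= x0.
have ws v : has_index (proj_seq x) v.+1 ->
  moves (proj_seq x) v \/ stutters (proj_seq x) v := proj_weak_step xc.
have [y [yc yx yinf ylast]] := destutter ws io cfg0 t0.
exists y; split=> //; apply/(imtl_sat_proj aPhi j0i fj0i (rho := spath x)) => //.
by move=> t c; rewrite yx spath_proj_seq.
Qed.

End Projection.

(** * Choice of the instances to keep *)

Section Cutoff.
Variables (l : tidx) (c n : nat).
Hypothesis c_bounds : (0 < c <= n)%N.

(** On [T1] both sizes compute to 1, so the identity has the right type and the one instance of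
    [U T1] is always kept. *)
Definition second_embedding (h : 'I_c -> 'I_n) (k : tidx) :
    'I_(sizes 1 c k) -> 'I_(sizes 1 n k) :=
  match k with T1 => id | T2 => h end.

(** What the formula forces one to keep in [U T2]: instance 1, whose ordinal is 0, if [l = T2], and
    nothing if [l = T1]. *)
Definition pinned : {set 'I_n} :=
  [set j : 'I_n | if l is T2 then j == 0 :> nat else false].

Lemma card_pinned : (#|pinned| <= if l is T2 then 1 else 0)%N.
Proof.
rewrite /pinned; case: l; first by rewrite (eq_card0 (A := [set _ | _])) // => j; rewrite inE.
case: n c_bounds => [|n' _]; first by rewrite leqn0 andbC; case: c.
rewrite -(cards1 (@ord0 n')) subset_leq_card //; apply/subsetP => j.
by rewrite !inE.
Qed.

Lemma exists_retaining (A : {set 'I_n}) :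
  (#|A :|: pinned| <= c)%N ->
  exists f : forall k, 'I_(sizes 1 c k) -> 'I_(sizes 1 n k),
    [/\ forall k, injective (f k),
        forall j, exists u, embed f u = existT _ T1 j,
        forall j, j \in A -> exists u, embed f u = existT _ T2 j
      & exists2 j0 : 'I_(sizes 1 c l), j0.+1 = 1%N & (f l j0).+1 = 1%N].
Proof.
move=> Ac; have /andP[c0 cn] := c_bounds.
have [|h h_inj hA] := @exists_injection_covering c _ (A :|: pinned).
  by rewrite Ac card_ord.
have n0 := leq_trans c0 cn.
(* If [l = T2], instance 1 must stay instance 1: transpose it into place. *)
pose i0 := Ordinal c0; pose j0 := Ordinal n0.
have [i1 hi1] : exists i1, l = T2 -> h i1 = j0.
  case El : l; first by exists i0.
  have [|i <-] := hA j0; last by exists i.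
  by rewrite !inE El eqxx orbT.
exists (second_embedding (h \o tperm i0 i1)); split.
- by case=> //=; apply: inj_comp => //; apply: perm_inj.
- by move=> j; exists (existT _ T1 j).
- move=> j jA; have [|i <-] := hA j; first by rewrite inE jA.
  by exists (existT (fun k => 'I_(sizes 1 c k)) T2 (tperm i0 i1 i));
     rewrite /embed /= tpermK.
- case: l hi1 => hi1 /=; first by exists ord0.
  by exists i0; rewrite //= tpermL hi1.
Qed.

(** Label a step by its mover in [U T2], or by [None] if it is a delay or a step of [U T1], which
    survives in any case. A label that recurs infinitely often gives [A]: one instance or none. *)
Lemma exists_infinite_mover (x : timed_seq R U (sizes 1 n)) :
  timed_computation x -> infinite x ->
  exists2 A : {set 'I_n}, (#|A| <= 1)%N &
    forall f : forall k, 'I_(sizes 1 c k) -> 'I_(sizes 1 n k),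
      (forall k, injective (f k)) ->
      (forall j, exists u, embed f u = existT _ T1 j) ->
      (forall j, j \in A -> exists u, embed f u = existT _ T2 j) ->
      forall N, exists2 v, (N <= v)%N & moves (proj_seq f x) v.
Proof.
move=> [_ _ xS] xinf.
pose covers (o : option 'I_n) (f : forall k, 'I_(sizes 1 c k) -> 'I_(sizes 1 n k)) :=
  if o is Some j then exists u, embed f u = existT _ T2 j else True.
have H v : exists o, forall f, (forall k, injective (f k)) ->
    (forall j, exists u, embed f u = existT _ T1 j) -> covers o f ->
    moves (proj_seq f x) v.
  have /xS[[d [d0 dl tE]]|[[[[] j] st] tE]] : has_index x v.+1.
  - by rewrite /has_index xinf.
  - by exists None => f _ _ _; left; exists d; split=> //; apply: proj_delay_step.
  - exists None => f f_inj /(_ j)[u uj] _.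
    by apply: (proj_moves f_inj (w := u)) => //; rewrite uj.
  - exists (Some j) => f f_inj _ [u uj].
    by apply: (proj_moves f_inj (w := u)) => //; rewrite uj.
have [e He] := choice H; have [o io] := infinite_pigeonhole e.
exists (if o is Some j then [set j] else set0).
  by case: o {io} => [j|]; rewrite ?cards1 ?cards0.
move=> f f_inj f1 f2 N; have [v Nv ev] := io N; exists v => //.
apply: He => //; rewrite ev; case: o {io ev} f2 => //= j f2.
by apply: f2; rewrite inE.
Qed.

Lemma exists_blockers (g : gstate R U (sizes 1 n)) :
  is_config g -> (forall g', ~ discrete_step g g') ->
  exists2 A : {set 'I_n}, (#|A| <= 2 * template_size (U T2))%N &
    forall f : forall k, 'I_(sizes 1 c k) -> 'I_(sizes 1 n k),
      (forall k, injective (f k)) ->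
      (forall j, exists u, embed f u = existT _ T1 j) ->
      (forall j, j \in A -> exists u, embed f u = existT _ T2 j) ->
      forall g', ~ discrete_step (proj f g) g'.
Proof.
move=> gc dead.
have [A Acard HA] := @exists_two_per_fiber _ (S T2)
  (fun j : 'I_n => loc g (existT (fun k => 'I_(sizes 1 n k)) T2 j)).
exists A => // f f_inj f1 f2; apply: proj_deadlock => // u w wu.
(* A kept [w] stands for itself. *)
have direct : (exists u', embed f u' = w) ->
    exists u', exists E : tag (embed f u') = tag w,
     u' <> u /\ ecast l (S l) E (loc g (embed f u')) = loc g w.
  case=> u' uw; subst w; exists u', erefl; split=> // uu.
  by apply: wu; rewrite uu.
case: w wu direct => -[] j wu direct; first exact: direct.
have [jA|[j1 [j2 [j1A j2A j12 s1 s2]]]] := HA j; first by apply: direct; apply: f2.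
have pick j' : j' \in A ->
    loc g (existT (fun k => 'I_(sizes 1 n k)) T2 j') = loc g (existT _ T2 j) ->
    existT _ T2 j' <> embed f u ->
    exists u', exists E : tag (embed f u') = T2,
     u' <> u /\ ecast l (S l) E (loc g (embed f u')) = loc g (existT _ T2 j).
  move=> /f2[u' uj'] sj' j'u; exists u'; rewrite uj'; exists erefl; split=> // uu.
  by apply: j'u; rewrite -uj' uu.
(* At most one of [j1] and [j2] is the mover; the other one stands in for [j]. *)
have [E1|] := pselect (existT _ T2 j1 = embed f u); last exact: pick.
apply: pick j2A s2 _; rewrite -E1 => E2; apply: j12; apply: val_inj.
exact: (congr1 (fun w : inst (sizes 1 n) => nat_of_ord (tagged w)) (esym E2)).
Qed.

(** The summand depending on [l] pays for [pinned], the other one for the instances that preserve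
    infinity or deadlock. For [QEfin] only [pinned] is kept, which has at most one element. *)
Lemma models_cutoff (Q : quantifier) (Phi : imtl S) :
  (match Q with
   | QE => 2 * template_size (U T2) + (if l is T2 then 1 else 0)
   | QEinf => 1 + (if l is T2 then 1 else 0)
   | QEfin => 1
   end <= c)%N ->
  only_about l 1 Phi ->
  models R U (sizes 1 n) Q Phi -> models R U (sizes 1 c) Q Phi.
Proof.
move=> Qc aPhi [x [xc xQ xPhi]]; pose e := (if l is T2 then 1 else 0)%N.
have cardU (A : {set 'I_n}) p : (#|A| <= p)%N -> (#|A :|: pinned| <= p + e)%N.
  by move=> Ap; rewrite (leq_trans (leq_card_setU _ _)) // leq_add ?card_pinned.
have S0 : (0 < template_size (U T2))%N.
  by apply/card_gt0P; exists (init_state (S T2)).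
have e1 : (e <= 1)%N by rewrite /e; case: l.
(* Shared by all cases: an [A] that fits into [c] together with [pinned] yields a projected
   computation satisfying [Phi]. *)
have project A : (#|A :|: pinned| <= c)%N -> forall
    (io : infinite x -> forall f : forall k, 'I_(sizes 1 c k) -> 'I_(sizes 1 n k),
      (forall k, injective (f k)) ->
      (forall j, exists u, embed f u = existT _ T1 j) ->
      (forall j, j \in A -> exists u, embed f u = existT _ T2 j) ->
      forall N, exists2 v, (N <= v)%N & moves (proj_seq f x) v),
    exists f (y : timed_seq R U (sizes 1 c)),
    [/\ [/\ forall k, injective (f k), forall j, exists u, embed f u = existT _ T1 j
        & forall j, j \in A -> exists u, embed f u = existT _ T2 j],
        timed_computation y, imtl_sat (spath y) Phi, infinite x -> infinite y
      & forall k, tlast x = Some k ->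
          exists2 K, tlast y = Some K & cfg y K = proj f (cfg x k)].
  move=> /exists_retaining[f [f_inj f1 f2 [j0 j01 fj01]]] io; exists f.
  have [|y [yc yPhi yinf ylast]] :=
    project_computation f_inj aPhi j01 fj01 xc xPhi; last by exists y.
  by move=> xinf; apply: io.
have projinf : infinite x -> (1 + e <= c)%N -> exists y : timed_seq R U (sizes 1 c),
    [/\ timed_computation y, infinite y & imtl_sat (spath y) Phi].
  move=> xinf ec; have [A A1 HA] := exists_infinite_mover xc xinf.
  have [||f [y [_ yc yPhi yinf _]]] := project A.
  - exact: leq_trans (cardU _ _ A1) ec.
  - by move=> _; apply: HA.
  - by exists y; split=> //; apply: yinf.
case: Q Qc xQ => [Qc [xinf|[k xk dead]]|Qc xinf|Qc [k xk]].
- have [|y [yc yinf yPhi]] := projinf xinf; last by exists y; split=> //; left.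
  (* One mover suffices here, and [2 * template_size (U T2)] is positive. *)
  by rewrite (leq_trans _ Qc) // leq_add2r muln_gt0.
- have hk : has_index x k by rewrite /has_index xk.
  have [A A1 HA] := exists_blockers (is_config_cfg xc hk) dead.
  have [||f [y [[f_inj f1 f2] yc yPhi _ ylast]]] := project A.
  + exact: leq_trans (cardU _ _ A1) Qc.
  + by rewrite /infinite xk.
  have [K yK cK] := ylast _ xk; exists y; split=> //; right; exists K => //.
  by rewrite cK; apply: HA.
- by have [y [yc yinf yPhi]] := projinf xinf Qc; exists y.
- have [||f [y [_ yc yPhi _ ylast]]] := project set0.
  + by rewrite (leq_trans (cardU _ 0%N _)) ?cards0 ?add0n ?(leq_trans e1).
  + by rewrite /infinite xk.
  have [K yK _] := ylast _ xk; by exists y; split=> //; exists K.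
Qed.

End Cutoff.
End Network.

Theorem theorem4 (R : realType) (S : tidx -> state_space)
    (U : forall l : tidx, template S l) (Q : quantifier) :
  (forall Phi : imtl S, only_about T2 1 Phi ->
     forall n : nat, (cutoff2 U Q <= n)%N ->
       models R U (sizes 1 n) Q Phi ->
       models R U (sizes 1 (cutoff2 U Q)) Q Phi) /\
  (forall Phi : imtl S, only_about T1 1 Phi ->
     forall n : nat, (cutoff1 U Q <= n)%N ->
       models R U (sizes 1 n) Q Phi ->
       models R U (sizes 1 (cutoff1 U Q)) Q Phi).
Proof.
have S0 : (0 < template_size (U T2))%N.
  by apply/card_gt0P; exists (init_state (S T2)).
(* For [l = T2] the extra summand is 1 and the bound is [cutoff2]; for [l = T1] it is 0 and the
   bound is [cutoff1]. *)
split=> Phi aPhi n cn; apply: (models_cutoff _ (l := _) _ aPhi).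
- by rewrite cn andbT; case: Q {cn} => //=; rewrite addn1.
- by case: Q {cn}.
- by rewrite cn andbT; case: Q {cn} => //=; rewrite muln_gt0.
- by case: Q {cn} => //=; rewrite addn0.
Qed.
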